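(* Let $T:[0,1]\to[0,1]$ be a dynamical system (a Borel measurable map) with an ACIM $\lambda_T$, let $\nu>0$, and let $\{Y_t\}_{t\ge1}$ be a pure chaotic $\beta$ARC model (as defined in the context) with $\mu_t=T^{t-1}(U_0)$, $t\ge 1$, where $U_0$ is distributed according to $\lambda_T$. Then $\{Y_t\}_{t\ge1}$ is (strictly) stationary, and its common marginal distribution $F_{Y_t}$ is absolutely continuous with respect to Lebesgue measure, with unconditional density $$f_{Y_t}(y)=\int_0^1 f_{Y_t\mid\mu_t}(y\mid z)\,\lambda_T(dz),\qquad 0<y<1,$$ where $$f_{Y_t\mid\mu_t}(y\mid z)=\frac{\Gamma(\nu)}{\Gamma(\nu z)\Gamma(\nu(1-z))}\,y^{\nu z-1}(1-y)^{\nu(1-z)-1},\qquad 0<y<1,\ 0<z<1,$$ is the conditional density of $Y_t$ given $\mu_t=z$.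
   Context: An ACIM for $T$ is a Borel probability measure $\lambda_T$ on $[0,1]$ that is absolutely continuous with respect to Lebesgue measure and $T$-invariant, i.e. $\lambda_T(T^{-1}(A))=\lambda_T(A)$ for all Borel $A\subset[0,1]$. $T^k$ is the $k$-fold composition of $T$ ($T^0$ the identity). Pure chaotic $\beta$ARC model: with $\mu_t=T^{t-1}(U_0)$ and $\mathscr{F}_t$ the $\sigma$-field generated by $U_0,Y_1,\dots,Y_t$, for each $t\ge1$, conditionally on $\mathscr{F}_{t-1}$, $Y_t$ has the beta density $$f(y;\mu_t,\nu\mid\mathscr{F}_{t-1})=\frac{\Gamma(\nu)}{\Gamma(\nu\mu_t)\Gamma(\nu(1-\mu_t))}\,y^{\nu\mu_t-1}(1-y)^{\nu(1-\mu_t)-1},\qquad 0<y<1.$$ (When $U_0\sim\lambda_T$, with probability $1$, $\mu_t\in(0,1)$ for all $t$, so this is well defined.) Strict stationarity means that all finite-dimensional distributions are invariant under time shifts. *)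

(* Defs.v *)
From HB Require Import structures.
From mathcomp Require Import all_boot all_order all_algebra.
From mathcomp Require Import all_classical all_reals all_analysis.
From mathcomp Require Import measurable_realfun.

Set Implicit Arguments.
Unset Strict Implicit.
Unset Printing Implicit Defensive.
Import Order.TTheory GRing.Theory Num.Theory.
Import numFieldNormedType.Exports.
Local Open Scope classical_set_scope.
Local Open Scope ring_scope.

(* Meaningful for x > 0. For x <= 0 the integral diverges and Gamma x = 0,
   because the real-valued integral sends +oo to 0. *)
Definition Gamma {R : realType} (x : R) : R :=
  \int[lebesgue_measure]_(t in `]0, +oo[) (t `^ (x - 1) * expR (- t)).

(* Beta density with mean z and precision nu, extended by 0 outside ]0, 1[.
   Meaningful for 0 < z < 1; at z = 0 and z = 1 it vanishes, by the convention
   on Gamma. *)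
Definition beta_density {R : realType} (nu z y : R) : R :=
  if 0 < y < 1 then
    Gamma nu / (Gamma (nu * z) * Gamma (nu * (1 - z)))
      * y `^ (nu * z - 1) * (1 - y) `^ (nu * (1 - z) - 1)
  else 0.

(* A map of [0, 1] into itself is a total function of which only the values
   on [0, 1] matter. *)
Definition dynamical_system {R : realType} (T : R -> R) : Prop :=
  set_fun `[0, 1] `[0, 1] T /\ measurable_fun (`[0, 1] : set R) T.

(* A probability on [0, 1] is a Borel probability on R concentrated there. *)
Definition is_ACIM {R : realType} (T : R -> R)
    (lambda : probability R R) : Prop :=
  [/\ lambda `[0, 1]%classic = 1%E,
      lambda `<< (@lebesgue_measure R)
    & forall A : set R, measurable A -> A `<=` `[0, 1] ->
        lambda (`[0, 1]%classic `&` T @^-1` A) = lambda A].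

(* g w is a density, with respect to Lebesgue measure, of a regular version of
   the conditional distribution of Y given the sigma-algebra G. *)
Definition is_cond_density {R : realType} {d : measure_display}
    {Omega : measurableType d} (P : probability Omega R)
    (G : set (set Omega)) (Y : Omega -> R) (g : Omega -> R -> R) : Prop :=
  [/\ forall w y, 0 <= g w y,
      forall w, measurable_fun [set: R] (g w),
      forall B : set R, measurable B ->
        forall A : set (\bar R), measurable A ->
        G ((fun w => \int[lebesgue_measure]_(y in B) (g w y)%:E)%E @^-1` A)
    & forall (E : set Omega) (B : set R),
        G E -> measurable B ->
        P (E `&` Y @^-1` B)
        = (\int[P]_(w in E) \int[lebesgue_measure]_(y in B) (g w y)%:E)%E].

Definition has_density {R : realType}
    (m : set R -> \bar R) (f : R -> \bar R) : Prop :=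
  [/\ measurable_fun [set: R] f,
      forall y, (0 <= f y)%E
    & forall A : set R, measurable A ->
        m A = (\int[lebesgue_measure]_(y in A) f y)%E].

(* The process is indexed by t >= 1: Y 0 plays no role here or below. *)
Definition strictly_stationary {R : realType} {d : measure_display}
    {Omega : measurableType d} (P : probability Omega R)
    (Y : nat -> {RV P >-> R}) : Prop :=
  forall (n h : nat) (t : 'I_n -> nat), (forall i, (1 <= t i)%N) ->
  forall A : set (n.-tuple R), measurable A ->
    P ((fun w => [tuple Y (t i + h)%N w | i < n]) @^-1` A)
    = P ((fun w => [tuple Y (t i) w | i < n]) @^-1` A).

Section chaotic_beta_ARC.
Context {R : realType} {d : measure_display} {Omega : measurableType d}.
Variables (P : probability Omega R) (T : R -> R).
Variables (U0 : {RV P >-> R})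
          (Y : nat -> {RV P >-> R}).

(* T^(t-1)(U0), for t >= 1 *)
Definition chaotic_mean (t : nat) (w : Omega) : R :=
  iter t.-1 T (U0 w).

Definition history (t : nat) : set (set Omega) :=
  <<s g_sigma_algebra_preimage U0 `|`
      \bigcup_(s in [set s | (1 <= s <= t)%N]) g_sigma_algebra_preimage (Y s) >>.

Definition pure_chaotic_beta_ARC (nu : R) : Prop :=
  (forall w, U0 w \in `[0, 1]) /\
  (forall t, (1 <= t)%N ->
    is_cond_density P (history t.-1) (Y t)
      (fun w => beta_density nu (chaotic_mean t w))).

End chaotic_beta_ARC.

Arguments strictly_stationary {R d Omega} P Y.
Arguments chaotic_mean {R d Omega} P T U0 t w.
Arguments pure_chaotic_beta_ARC {R d Omega} P T U0 Y nu.

(* Main.v *)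
(* Write K(z, B) for the mass that the beta law of mean z and precision nu gives
   to B. Conditioning successively on the past gives, for boxes,
   P(U0 in C, Y_(h+1) in B_1, ..., Y_(h+N) in B_N)
     = int_C prod_k K(T^(h+k-1) z, B_k) lambda(dz).
   For C the whole line the right-hand side is the integral of a function of
   T^h z, so by invariance of lambda it does not depend on h; boxes form a
   pi-system, whence stationarity. The case N = 1 and Tonelli give the
   marginal density. *)
Require Import Defs.
From HB Require Import structures.
From mathcomp Require Import all_boot all_order all_algebra.
From mathcomp Require Import all_classical all_reals all_analysis.
From mathcomp Require Import measurable_realfun.
Import Order.TTheory GRing.Theory Num.Theory.
Import numFieldNormedType.Exports.
Local Open Scope classical_set_scope.
Local Open Scope ring_scope.

(** * Joint measurability of the beta density in mean and point *)

Lemma measurable_fun_powR {d : measure_display} {X : measurableType d}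
    {R : realType} (f g : X -> R) :
  measurable_fun [set: X] f -> measurable_fun [set: X] g ->
  measurable_fun [set: X] (fun x => f x `^ g x).
Proof.
move=> mf mg; rewrite /powR; apply: measurable_fun_ifT => /=.
- exact: measurable_fun_eqr.
- apply: (measurableT_comp (f := fun b : bool => b%:R : R)) => //.
  exact: measurable_fun_eqr.
- apply: measurableT_comp => //; apply: measurable_funM => //.
  exact: measurableT_comp.
Qed.

(** Once the constraint [0 < t] is moved into the integrand, [Gamma] is the finite part of a partial
    integral of a nonnegative jointly measurable function, so Tonelli applies. *)
Lemma measurable_Gamma {R : realType} : measurable_fun [set: R] (@Gamma R).
Proof.
pose F (p : R * R) : \bar R :=
  (if 0 < p.2 then p.2 `^ (p.1 - 1) * expR (- p.2) else 0)%:E.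
have F0 p : (0 <= F p)%E.
  by rewrite lee_fin; case: ifPn => // _; rewrite mulr_ge0 ?powR_ge0 ?expR_ge0.
have mF : measurable_fun [set: R * R] F.
  apply/measurable_EFinP; apply: measurable_fun_ifT => //=.
  - exact: measurable_fun_ltr.
  - apply: measurable_funM.
      by apply: measurable_fun_powR => //; exact: measurable_funB.
    by apply: measurableT_comp => //; exact: measurableT_comp.
have -> : @Gamma R =
    fine \o (fun x => \int[@lebesgue_measure R]_t F (x, t))%E.
  apply/funext => x; rewrite /Gamma /Rintegral /= integral_mkcond.
  congr fine; apply: eq_integral => t _; rewrite /F /= /patch.
  by rewrite mem_setE in_itv /= andbT; case: ifPn.
apply: measurableT_comp => //.
exact: (measurable_fun_fubini_tonelli_F (m2 := @lebesgue_measure R) F).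
Qed.

Lemma Gamma_ge0 {R : realType} (x : R) : 0 <= Gamma x.
Proof.
by apply: Rintegral_ge0 => t _; rewrite mulr_ge0 ?powR_ge0 ?expR_ge0.
Qed.

Lemma beta_density_ge0 {R : realType} (nu z y : R) : 0 <= beta_density nu z y.
Proof.
rewrite /beta_density; case: ifPn => // _.
by rewrite !mulr_ge0 ?invr_ge0 ?mulr_ge0 ?powR_ge0 ?Gamma_ge0.
Qed.

Lemma measurable_beta_density {R : realType} (nu : R) :
  measurable_fun [set: R * R] (fun p => beta_density nu p.1 p.2).
Proof.
have m1 : measurable_fun [set: R * R] (fun p => 1 - p.1).
  exact: measurable_funB.
rewrite /beta_density; apply: measurable_fun_ifT => //=.
- by apply: measurable_and; exact: measurable_fun_ltr.
apply: measurable_funM; [apply: measurable_funM|].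
- apply: measurable_funM => //.
  (* The inverse becomes the power -1, a measurable function of the base; the two agree on
     nonnegative reals, both being 0 at 0. *)
  under eq_fun do rewrite -powR_inv1 ?mulr_ge0 ?Gamma_ge0//.
  apply: (measurableT_comp (measurable_powR _)).
  apply: measurable_funM; apply: (measurableT_comp measurable_Gamma);
    exact: measurable_funM.
- apply: measurable_fun_powR => //.
  by apply: measurable_funB => //; exact: measurable_funM.
- apply: measurable_fun_powR; apply: measurable_funB => //.
  exact: measurable_funM.
Qed.

(** * Integration against a measure given by a density *)

Section density.

Import HBNNSimple.

(** For indicators this is the hypothesis on [nu], for simple functions it follows by linearity over
    the level sets, and monotone convergence on both sides gives it for [f]. *)
Lemma ge0_integral_density {d : measure_display} {X : measurableType d}
    {R : realType} (mu nu : {measure set X -> \bar R}) (g : X -> \bar R) :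
  measurable_fun [set: X] g -> (forall x, 0 <= g x)%E ->
  (forall A, measurable A -> nu A = \int[mu]_(x in A) g x)%E ->
  forall (D : set X) (f : X -> \bar R), measurable D ->
  measurable_fun D f -> (forall x, 0 <= f x)%E ->
  (\int[nu]_(x in D) f x = \int[mu]_(x in D) (f x * g x))%E.
Proof.
move=> mg g0 nug D f mD mf f0.
pose h := nnsfun_approx mD mf.
have hf x : D x -> EFin \o h ^~ x @ \oo --> f x.
  by move=> Dx; apply: cvg_nnsfun_approx.
have hfg x : D x -> ((h n x)%:E * g x)%E @[n --> \oo] --> (f x * g x)%E.
  (* A zero product is treated apart because it may have the form 0 times infinity, where limits do
     not multiply. There either [g x] is 0, or [f x] is 0 and forces [h n x] to be 0 from below, so
     every term vanishes. *)
  move=> Dx; have [fg0|fg0] := eqVneq (f x * g x)%E 0%E; last first.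
    by apply: cvgeM; [exact: neq0_mule_def|exact: hf|exact: cvg_cst].
  suff hg0 n : ((h n x)%:E * g x)%E = 0%E.
    rewrite fg0 (_ : (fun n => _) = cst 0%E); first exact: cvg_cst.
    exact/funext.
  move/eqP: fg0; rewrite mule_eq0 => /orP[/eqP fx0|/eqP->]; last exact: mule0.
  suff -> : (h n x)%:E = 0%E by rewrite mul0e.
  apply/eqP; rewrite eq_le [X in _ && X]lee_fin fun_ge0 andbT -fx0.
  by rewrite /h nnsfun_approxE; exact: le_approx.
have hmono x m n : (m <= n)%N -> h m x <= h n x.
  by move=> mn; exact/lefP/nd_nnsfun_approx.
transitivity (limn (fun n => \int[nu]_(x in D) (h n x)%:E)%E).
  rewrite -monotone_convergence//.
  - by apply: eq_integral => x /[!inE] Dx; apply/esym/cvg_lim => //; exact: hf.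
  - by move=> n; exact/measurable_EFinP/measurable_funTS.
  - by move=> n x _; rewrite lee_fin.
  - by move=> x _ m n mn; rewrite lee_fin; exact: hmono.
transitivity (limn (fun n => \int[mu]_(x in D) ((h n x)%:E * g x))%E);
  last first.
  rewrite -monotone_convergence//.
  - by apply: eq_integral => x /[!inE] Dx; apply/cvg_lim => //; exact: hfg.
  - move=> n; apply: emeasurable_funM; apply: measurable_funTS => //.
    exact/measurable_EFinP.
  - by move=> n x _; rewrite mule_ge0 ?lee_fin.
  - by move=> x _ m n mn; rewrite lee_wpmul2r ?lee_fin//; exact: hmono.
congr (limn _); apply/funext => n.
transitivity (\int[nu]_(x in D)
    \sum_(y \in range (h n)) (y * \1_(h n @^-1` [set y]) x)%:E)%E.
  by apply: eq_integral => x _; rewrite fsumEFin// -fimfunE.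
have mind y : measurable_fun D (fun x => (y * \1_(h n @^-1` [set y]) x)%:E).
  by apply/measurable_funTS/measurable_EFinP; exact: measurable_funM.
rewrite ge0_integral_fsum//; last by move=> y x _; exact: nnfun_muleindic_ge0.
transitivity (\int[mu]_(x in D)
    \sum_(y \in range (h n)) ((y * \1_(h n @^-1` [set y]) x)%:E * g x))%E.
  rewrite ge0_integral_fsum//; last 2 first.
  - by move=> y; apply: emeasurable_funM => //; exact: measurable_funTS.
  - by move=> y x _; rewrite mule_ge0// nnfun_muleindic_ge0.
  apply: eq_fsbigr => y /[!inE] -[z _ hz].
  have y0 : 0 <= y by rewrite -hz.
  have mA : measurable (h n @^-1` [set y]) by [].
  rewrite (integralZl_indic _ (fun r => h n @^-1` [set r]))//; last first.
    by rewrite ltNge y0.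
  rewrite integral_indic// nug; last exact: measurableI.
  under [RHS]eq_integral do rewrite EFinM -muleA.
  rewrite ge0_integralZl//; last 2 first.
  - apply: emeasurable_funM; apply: measurable_funTS => //.
    exact/measurable_EFinP.
  - by move=> x _; rewrite mule_ge0 ?lee_fin.
  congr (_ * _)%E; rewrite setIC integral_mkcondr.
  apply: eq_integral => x _; rewrite indicE patchE.
  by case: ifPn; rewrite ?mul1e ?mul0e.
apply: eq_integral => x _; rewrite -ge0_mule_fsuml; last first.
  by move=> y; exact: nnfun_muleindic_ge0.
by rewrite fsumEFin// -fimfunE.
Qed.

End density.

(** The restriction of [mu] to [E] has density the indicator of [E]. *)
Lemma ge0_integral_mrestr {d : measure_display} {X : measurableType d}
    {R : realType} (mu : {measure set X -> \bar R}) (E : set X)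
    (mE : measurable E) (D : set X) (f : X -> \bar R) :
  measurable D -> measurable_fun D f -> (forall x, 0 <= f x)%E ->
  (\int[mrestr mu mE]_(x in D) f x = \int[mu]_(x in D `&` E) f x)%E.
Proof.
move=> mD mf f0.
rewrite (@ge0_integral_density _ _ _ mu (mrestr mu mE) (EFin \o \1_E))//=.
- rewrite integral_mkcondr; apply: eq_integral => x _.
  by rewrite patchE indicE; case: ifPn; rewrite ?mule1 ?mule0.
- exact/measurable_EFinP.
- by move=> A mA; rewrite integral_indic// /mrestr setIC.
Qed.

(** * Uniqueness of measures on tuples, and invariant integrals *)

Lemma measurable_tuple_box {d : measure_display} {X : measurableType d}
    (n : nat) (B : 'I_n -> set X) :
  (forall i, measurable (B i)) ->
  measurable [set x : n.-tuple X | forall i, B i (tnth x i)].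
Proof.
move=> mB.
rewrite [X in measurable X](_ : _ = \bigcap_i (fun x => tnth x i) @^-1` B i).
  apply: fin_bigcap_measurable => // i _.
  by rewrite -[_ @^-1` _]setTI; exact: measurable_tnth.
by apply/seteqP; split => x /= Bx i *; exact: Bx.
Qed.

(** Boxes are stable under intersection and generate the product sigma-algebra. The whole space is
    itself a box, so the finiteness of [m1] supplies the exhausting sequence, a constant one. *)
Lemma measure_tuple_unique {d : measure_display} {X : measurableType d}
    {R : realType} (n : nat) (m1 m2 : {measure set (n.-tuple X) -> \bar R}) :
  (m1 [set: n.-tuple X] < +oo)%E ->
  (forall B : 'I_n -> set X, (forall i, measurable (B i)) ->
    m1 [set x | forall i, B i (tnth x i)] =
    m2 [set x | forall i, B i (tnth x i)]) ->
  forall A, measurable A -> m1 A = m2 A.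
Proof.
move=> m1oo m12 A mA.
pose G : set (set (n.-tuple X)) := [set C | exists2 B : 'I_n -> set X,
  (forall i, measurable (B i)) & C = [set x | forall i, B i (tnth x i)]].
have GT : G setT.
  by exists (fun=> setT) => //; apply/seteqP; split.
apply: (measure_unique G (fun=> setT)) => //.
- apply/seteqP; split; last first.
    apply: smallest_sub; first exact: sigma_algebra_measurable.
    by move=> _ [B mB ->]; exact: measurable_tuple_box.
  apply: smallest_sub; first exact: smallest_sigma_algebra.
  move=> C; rewrite -bigcup_seq => -[i _ [B mB <-]].
  (* A cylinder over coordinate [i] is the box whose other sides are the whole space. *)
  apply: sub_gen_smallest; exists (fun j => if j == i then B else setT).
    by move=> j; case: ifP.
  apply/seteqP; split => [x [_ Bx] j|x Bx].
    by case: ifPn => // /eqP ->.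
  by split => //; have := Bx i; rewrite eqxx.
- move=> _ _ [B mB ->] [C mC ->]; exists (fun i => B i `&` C i).
    by move=> i; exact: measurableI.
  apply/seteqP; split => [x [Bx Cx] i|x BCx]; first by split.
  by split => i; case: (BCx i).
- by rewrite bigcup_const//; exists 0%N.
- by move=> _ [B mB ->]; exact: m12.
Qed.

(** Invariance says that the image of [mu] under [S] is [mu]; the rest is the change of variables
    formula. *)
Lemma ge0_integral_invariant {d : measure_display} {X : measurableType d}
    {R : realType} (mu : {measure set X -> \bar R}) (S : X -> X)
    (f : X -> \bar R) :
  measurable_fun [set: X] S ->
  (forall A, measurable A -> mu (S @^-1` A) = mu A) ->
  measurable_fun [set: X] f -> (forall x, 0 <= f x)%E ->
  (\int[mu]_x f (S x) = \int[mu]_x f x)%E.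
Proof.
move=> mS muS mf f0.
pose S' : {mfun X >-> X} := HB.pack S (isMeasurableFun.Build _ _ _ _ S mS).
transitivity (\int[pushforward mu S']_x f x)%E.
  by rewrite ge0_integral_pushforward// preimage_setT.
by apply: eq_measure_integral => A mA _; exact: muS.
Qed.

(** * Stationarity for a general kernel [K] driven by the iterates of a measure-preserving map *)

Section markov_iteration.
Context {R : realType} {d : measure_display} {Omega : measurableType d}.
Context (P : probability Omega R) (S : R -> R) (lambda : probability R R).
Context (U0 : {RV P >-> R}) (Y : nat -> {RV P >-> R}).
Context (K : R -> set R -> \bar R).
Hypothesis mS : measurable_fun [set: R] S.
Hypothesis Slambda : forall A : set R, measurable A ->
  lambda (S @^-1` A) = lambda A.
Hypothesis U0lambda : forall A : set R, measurable A ->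
  P (U0 @^-1` A) = lambda A.
Hypothesis K0 : forall z B, (0 <= K z B)%E.
Hypothesis mK : forall B, measurable B -> measurable_fun [set: R] (K^~ B).
Hypothesis YK : forall (n : nat) (E : set Omega) (B : set R),
  history U0 Y n E -> measurable B ->
  P (E `&` Y n.+1 @^-1` B) = (\int[P]_(w in E) K (iter n S (U0 w)) B)%E.

(** Index [k] counts from 0 and stands for time [h + k + 1], whose mean is the iterate of order
    [h + k]; this is the exponent in [weight]. *)
Let boxes (h N : nat) (B : nat -> set R) : set Omega :=
  \big[setI/setT]_(k < N) (Y (h + k).+1 @^-1` B k).

Let weight (h N : nat) (B : nat -> set R) (z : R) : \bar R :=
  (\big[*%E/1]_(k < N) K (iter (h + k) S z) (B k))%E.

Let measurable_iter n : measurable_fun [set: R] (iter n S).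
Proof.
elim: n => [|n IH]; first exact: measurable_id.
exact: (measurableT_comp mS IH).
Qed.

Let iter_invariant n (A : set R) : measurable A ->
  lambda (iter n S @^-1` A) = lambda A.
Proof.
elim: n A => //= n IH A mA.
have mSA : measurable (S @^-1` A) by rewrite -[_ @^-1` _]setTI; exact: mS.
exact: etrans (IH _ mSA) (Slambda _ mA).
Qed.

Let weight_ge0 h N B z : (0 <= weight h N B z)%E.
Proof. by rewrite /weight; elim/big_ind: _ => // x y; exact: mule_ge0. Qed.

Let measurable_weight h N B : (forall k, measurable (B k)) ->
  measurable_fun [set: R] (weight h N B).
Proof.
move=> mB; rewrite /weight; elim: N => [|N IH].
  by under eq_fun do rewrite big_ord0; exact: measurable_cst.
under eq_fun do rewrite big_ord_recr/=.
apply: emeasurable_funM => //.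
exact: (measurableT_comp (mK _ (mB N)) (measurable_iter _)).
Qed.

Lemma history_U0 n (C : set R) : measurable C -> history U0 Y n (U0 @^-1` C).
Proof.
by move=> mC; apply: sub_gen_smallest; left; exists C; rewrite ?setTI.
Qed.

Lemma history_Y n k (B : set R) : (k < n)%N -> measurable B ->
  history U0 Y n (Y k.+1 @^-1` B).
Proof.
move=> kn mB; apply: sub_gen_smallest; right; exists k.+1 => //=.
by exists B; rewrite ?setTI.
Qed.

Lemma history_setI n (E F : set Omega) :
  history U0 Y n E -> history U0 Y n F -> history U0 Y n (E `&` F).
Proof. exact: (@measurableI _ (g_sigma_algebraType _)). Qed.

Let history_boxes h N B : (forall k, measurable (B k)) ->
  history U0 Y (h + N) (boxes h N B).
Proof.
move=> mB; rewrite /boxes; elim/big_ind: _ => [|E F|k _].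
- by rewrite -(preimage_setT U0); exact: history_U0.
- exact: history_setI.
- by apply: history_Y => //; rewrite ltn_add2l.
Qed.

(* Fixing the offset [h] makes total mass [K z setT = 1] unnecessary: the first
   [h] observations are never integrated out. *)
Lemma joint_law h N B (C : set R) : (forall k, measurable (B k)) ->
  measurable C ->
  P (U0 @^-1` C `&` boxes h N B) = (\int[lambda]_(z in C) weight h N B z)%E.
Proof.
move=> mB; elim: N C => [|N IH] C mC.
  rewrite /boxes big_ord0 setIT U0lambda//.
  under eq_integral do rewrite /weight big_ord0.
  by rewrite integral_cst// mul1e.
have mboxes : measurable (boxes h N B).
  rewrite /boxes; elim/big_ind: _ => [//|E F|k _]; first exact: measurableI.
  exact: measurable_funPTI.
have mKN : measurable_fun [set: R] (fun z => K (iter (h + N) S z) (B N)).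
  exact: (measurableT_comp (mK _ (mB N)) (measurable_iter _)).
(* The last observation is conditioned on its past: the start in [C] and the first [N] constraints
   form an event of the history up to time [h + N]. *)
rewrite /boxes big_ord_recr/= -/(boxes h N B) setIA YK//; last first.
  by apply: history_setI; [exact: history_U0|exact: history_boxes].
have mU0C : measurable (U0 @^-1` C) by exact: measurable_funPTI.
(* The constraints on [Y] are absorbed into the measure, leaving an integrand that depends on [U0]
   alone and can be carried to the real line by the image under [U0]. *)
rewrite -(@ge0_integral_mrestr _ _ _ P _ mboxes _
    (fun w => K (iter (h + N) S (U0 w)) (B N)))//; last first.
  apply: measurable_funTS; exact: measurableT_comp mKN _.
rewrite -[LHS](@ge0_integral_pushforward _ _ _ _ _ U0 _ (mrestr P mboxes) C
    (fun z => K (iter (h + N) S z) (B N)))//; last exact: measurable_funTS.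
(* The induction hypothesis, kept general in [C], says exactly that this image measure has density
   [weight h N B] with respect to [lambda]. *)
rewrite (@ge0_integral_density _ _ _ lambda _ (weight h N B))//.
- by apply: eq_integral => z _; rewrite /weight big_ord_recr/= muleC.
- exact: measurable_weight.
- exact: measurable_funTS.
Qed.

(** The weight with offset [h] at [z] is the weight with offset 0 at the [h]-th iterate of [z], and
    [lambda] is invariant under that iterate. *)
Lemma boxes_shift h N B : (forall k, measurable (B k)) ->
  P (boxes h N B) = P (boxes 0 N B).
Proof.
move=> mB; rewrite -[boxes h N B]setTI -[boxes 0 N B]setTI.
rewrite -(preimage_setT U0) !joint_law//.
rewrite -(ge0_integral_invariant lambda (iter h S) (weight 0 N B))//;
  last 2 first.
- exact: iter_invariant.
- exact: measurable_weight.
apply: eq_integral => z _; apply: eq_bigr => k _.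
by rewrite add0n addnC iterD.
Qed.

Lemma markov_marginal n B : measurable B ->
  P (Y n.+1 @^-1` B) = (\int[lambda]_z K z B)%E.
Proof.
move=> mB; transitivity (P (boxes n 1 (fun=> B))).
  by rewrite /boxes big_ord1 addn0.
rewrite boxes_shift// -[boxes _ _ _]setTI -(preimage_setT U0) joint_law//.
by apply: eq_integral => z _; rewrite /weight big_ord1.
Qed.

Lemma markov_strictly_stationary : strictly_stationary P Y.
Proof.
move=> n h t t1 A mA.
have mtup g : measurable_fun [set: Omega] (fun w => [tuple Y (g i) w | i < n]).
  apply/measurable_fun_tnthP => i.
  rewrite (_ : _ \o _ = Y (g i))//.
  by apply/funext => w; rewrite /= tnth_mktuple.
pose tup g : {mfun Omega >-> n.-tuple R} :=
  HB.pack (fun w => [tuple Y (g i) w | i < n])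
    (isMeasurableFun.Build _ _ _ _ _ (mtup g)).
apply: (measure_tuple_unique n (pushforward P (tup (fun i => t i + h)%N))
  (pushforward P (tup t))) => //.
  by rewrite [ltLHS](_ : _ = P setT)// probability_setT ltry.
(* The times [t i] may repeat, come in any order and leave gaps. All constraints on time [k + 1] are
   intersected into [B' k], which is the whole space when there are none; this yields a box over
   consecutive times up to the largest [t i]. *)
move=> B mB; pose B' k := \bigcap_(i in [set i | t i = k.+1]) B i.
have mB' k : measurable (B' k) by exact: fin_bigcap_measurable.
have boxE l : (fun w => [tuple Y (t i + l)%N w | i < n]) @^-1`
    [set x | forall i, B i (tnth x i)] = boxes l (\max_i t i) B'.
  rewrite /boxes -(bigcap_mkord (\max_i t i)
    (fun k => Y (l + k).+1 @^-1` B' k)).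
  apply/seteqP; split => [w Bw k _ i /= tik|w B'w i /=].
    by have := Bw i; rewrite tnth_mktuple tik addSn addnC.
  rewrite tnth_mktuple -(prednK (t1 i)) addSn addnC.
  have tiN : ((t i).-1 < \max_i t i)%N.
    by rewrite prednK; [exact: leq_bigmax|exact: t1].
  by apply: (B'w _ tiN i); rewrite /= prednK//; exact: t1.
transitivity (P (boxes h (\max_i t i) B')); first by rewrite -boxE.
rewrite boxes_shift// -boxE.
by under eq_fun do under eq_mktuple do rewrite addn0.
Qed.

End markov_iteration.

(** * The beta law as a kernel, and its mixture over [lambda] *)

Definition beta_kernel {R : realType} (nu z : R) (B : set R) : \bar R :=
  (\int[lebesgue_measure]_(y in B) (beta_density nu z y)%:E)%E.

Lemma beta_kernel_ge0 {R : realType} (nu z : R) (B : set R) :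
  (0 <= beta_kernel nu z B)%E.
Proof. by apply: integral_ge0 => y _; rewrite lee_fin beta_density_ge0. Qed.

(** Moving [B] into the integrand leaves an integral over the whole line, the form in which Tonelli
    is applied below. *)
Lemma beta_kernelE {R : realType} (nu z : R) (B : set R) :
  beta_kernel nu z B =
  (\int[lebesgue_measure]_y (beta_density nu z y * \1_B y)%:E)%E.
Proof.
rewrite /beta_kernel integral_mkcond; apply: eq_integral => y _.
by rewrite patchE indicE; case: ifPn => _; rewrite ?mulr1 ?mulr0.
Qed.

Lemma measurable_beta_density_indic {R : realType} (nu : R) (B : set R) :
  measurable B -> measurable_fun [set: R * R]
    (fun p => (beta_density nu p.1 p.2 * \1_B p.2)%:E).
Proof.
move=> mB; apply/measurable_EFinP/measurable_funM.
  exact: measurable_beta_density.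
apply: (measurableT_comp (f := \1_B : R -> R)) => //; exact: measurable_indic.
Qed.

Lemma measurable_beta_kernel {R : realType} (nu : R) (B : set R) :
  measurable B -> measurable_fun [set: R] (fun z => beta_kernel nu z B).
Proof.
move=> mB; under eq_fun do rewrite beta_kernelE.
apply: (measurable_fun_fubini_tonelli_F (m2 := @lebesgue_measure R)
  (fun p => (beta_density nu p.1 p.2 * \1_B p.2)%:E)).
- exact: measurable_beta_density_indic.
- by move=> p; rewrite lee_fin mulr_ge0 ?beta_density_ge0.
Qed.

Lemma measurable_mixture {R : realType} (lambda : probability R R) (nu : R) :
  measurable_fun [set: R] (fun y => \int[lambda]_z (beta_density nu z y)%:E)%E.
Proof.
apply: (measurable_fun_fubini_tonelli_G (m1 := lambda)
  (fun p => (beta_density nu p.1 p.2)%:E)).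
- by apply/measurable_EFinP; exact: measurable_beta_density.
- by move=> p; rewrite lee_fin beta_density_ge0.
Qed.

(** Tonelli: the left side is the marginal law of an observation, so the inner integral on the right
    is its density. *)
Lemma integral_beta_kernel {R : realType} (lambda : probability R R) (nu : R)
    (B : set R) : measurable B ->
  (\int[lambda]_z beta_kernel nu z B = \int[lebesgue_measure]_(y in B)
     \int[lambda]_z (beta_density nu z y)%:E)%E.
Proof.
move=> mB; under eq_integral do rewrite beta_kernelE.
rewrite [LHS](fubini_tonelli (m1 := lambda) (m2 := @lebesgue_measure R)
  (fun p => (beta_density nu p.1 p.2 * \1_B p.2)%:E))//=.
- rewrite [RHS]integral_mkcond; apply: eq_integral => y _.
  rewrite patchE indicE; case: ifPn => _.
    by under eq_integral do rewrite mulr1.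
  by under eq_integral do rewrite mulr0; rewrite integral0.
- exact: measurable_beta_density_indic.
- by move=> p; rewrite lee_fin mulr_ge0 ?beta_density_ge0.
Qed.

(** * Sets of full probability, and the beta model *)

Lemma probability_setI_full {d : measure_display} {X : measurableType d}
    {R : realType} (P : probability X R) (D A : set X) :
  measurable D -> P D = 1%E -> measurable A -> P (A `&` D) = P A.
Proof.
move=> mD PD mA.
have PDC : P (~` D) = 0%E by rewrite probability_setC// PD subee.
rewrite [RHS](measureDI P mA mD).
rewrite (@subset_measure0 _ _ _ P (A `\` D) (~` D)) ?add0e//.
- exact: measurableD.
- exact: measurableC.
Qed.

Lemma ge0_integral_full {d : measure_display} {X : measurableType d}
    {R : realType} (P : probability X R) (D : set X) (f : X -> \bar R) :
  measurable D -> P D = 1%E -> measurable_fun [set: X] f ->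
  (forall x, 0 <= f x)%E -> (\int[P]_(x in D) f x = \int[P]_x f x)%E.
Proof.
move=> mD PD mf f0; rewrite -[D in LHS]setTI -(ge0_integral_mrestr _ _ mD)//.
by apply: eq_measure_integral => A mA _; exact: probability_setI_full.
Qed.

Theorem corollary2p2 (R : realType) (d : measure_display)
    (Omega : measurableType d) (P : probability Omega R)
    (T : R -> R) (hT : dynamical_system T)
    (lambda : probability R R) (hlambda : is_ACIM T lambda)
    (nu : R) (hnu : 0 < nu)
    (U0 : {RV P >-> R})
    (Y : nat -> {RV P >-> R})
    (hY : pure_chaotic_beta_ARC P T U0 Y nu)
    (hU0 : forall A : set R, measurable A ->
       distribution P U0 A = lambda A) :
  strictly_stationary P Y /\
  forall t : nat, (1 <= t)%N ->
    [/\ distribution P (Y t) `<< (@lebesgue_measure R),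
        has_density (distribution P (Y t))
          (fun y => (\int[lambda]_(z in (`[0%R, 1%R] : set R)) (beta_density nu z y)%:E)%E)
      & is_cond_density P (g_sigma_algebra_preimage (chaotic_mean P T U0 t)) (Y t)
          (fun w => beta_density nu (chaotic_mean P T U0 t w))].
Proof.
case: hT => T01 mT; case: hlambda => lam01 _ Tlambda.
case: hY => U01 hY.
pose D : set R := `[0, 1]%classic.
have mD : measurable D by exact: measurable_itv.
(* [T] is measurable on [0, 1] only; extending it by the default value outside
   changes none of the iterates started from [U0]. *)
pose S := T \_ D.
have mS : measurable_fun [set: R] S := (measurable_restrictT T mD).1 mT.
have SE z : D z -> S z = T z by move=> Dz; rewrite /S patchE mem_set.
have iterS n z : D z -> D (iter n T z) /\ iter n S z = iter n T z.
  move=> Dz; elim: n => //= n [Dn ->]; split; [exact: T01|exact: SE].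
have Slambda (A : set R) : measurable A -> lambda (S @^-1` A) = lambda A.
  move=> mA; have mSA : measurable (S @^-1` A).
    by rewrite -[_ @^-1` _]setTI; exact: mS.
  (* Invariance of [T] is given for subsets of [0, 1], so both sides are first cut down to [D],
     which carries all the mass of [lambda]. *)
  rewrite -(probability_setI_full _ D _ mD lam01 mSA).
  rewrite -(probability_setI_full _ D _ mD lam01 mA) -(Tlambda (A `&` D));
    last 2 first.
  - exact: measurableI.
  - exact: subIsetr.
  congr (lambda _); apply/seteqP; split => [z [Sz Dz]|z [Dz [Tz _]]].
    by split=> //; split; [rewrite -SE|exact: T01].
  by split=> //=; rewrite SE.
have U0lambda (A : set R) : measurable A -> P (U0 @^-1` A) = lambda A.
  exact: hU0.
have meanS n : chaotic_mean P T U0 n.+1 = fun w => iter n S (U0 w).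
  by apply/funext => w; have [_ ->] := iterS n (U0 w) (U01 w).
have miter n : measurable_fun [set: R] (iter n S).
  elim: n => [|n IH]; first exact: measurable_id.
  exact: (measurableT_comp mS IH).
have YK (n : nat) (E : set Omega) (B : set R) : history U0 Y n E ->
    measurable B -> P (E `&` Y n.+1 @^-1` B) =
    (\int[P]_(w in E) beta_kernel nu (iter n S (U0 w)) B)%E.
  move=> hE mB; have [_ _ _ condE] := hY n.+1 isT.
  rewrite (condE E B hE mB) meanS.
  by apply: eq_integral => w _; rewrite /beta_kernel.
have K0 := beta_kernel_ge0 nu; have mK := measurable_beta_kernel nu.
split.
  exact: (markov_strictly_stationary P S lambda U0 Y (beta_kernel nu)).
case=> // n _.
have mixD y : (\int[lambda]_(z in `[0%R, 1%R]) (beta_density nu z y)%:E =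
    \int[lambda]_z (beta_density nu z y)%:E)%E.
  apply: ge0_integral_full => //.
  - apply/measurable_EFinP.
    exact: (measurable_fun_pair1 _ (measurable_beta_density nu)).
  - by move=> z; rewrite lee_fin beta_density_ge0.
have Ydens (A : set R) : measurable A -> distribution P (Y n.+1) A =
    (\int[lebesgue_measure]_(y in A)
       \int[lambda]_(z in `[0%R, 1%R]) (beta_density nu z y)%:E)%E.
  move=> mA; under eq_integral do rewrite mixD.
  rewrite -integral_beta_kernel//.
  exact: (markov_marginal P S lambda U0 Y (beta_kernel nu)).
have mmix : measurable_fun [set: R]
    (fun y => \int[lambda]_(z in `[0%R, 1%R]) (beta_density nu z y)%:E)%E.
  by under eq_fun do rewrite mixD; exact: measurable_mixture.
split.
(* Absolute continuity is read off the density: its integral over a null set is 0. *)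
- apply/null_content_dominatesP => A mA A0.
  by rewrite Ydens// null_set_integral//; exact: measurable_funTS.
- split => //.
  by move=> y; apply: integral_ge0 => z _; rewrite lee_fin beta_density_ge0.
(* The sigma-algebra of the mean is smaller than the history, and the conditional density depends on
   the past only through the mean, so it also serves given the mean alone. *)
- have [g0 mg _ hE] := hY n.+1 isT.
  split => //.
  + move=> B mB A mA; exists ((fun z => beta_kernel nu z B) @^-1` A).
      by rewrite -[_ @^-1` _]setTI; exact: mK.
    by rewrite setTI.
  (* An event about the mean at time [n + 1] is an event about [U0], hence belongs to the history up
     to time [n]. *)
  + move=> E B [C mC <-] mB; apply: hE => //.
    rewrite setTI meanS; apply: history_U0 (iter n S @^-1` C) _.
    by rewrite -[_ @^-1` _]setTI; exact: miter.
Qed.
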